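(* Let $R$ be an eDCTRS. Then: (1) $R$ is $\mathbb{U}_{\mathrm{opt}}$-NE iff $(R)^{-1}$ is a 3-eDCTRS; (2) if $R$ is $\mathbb{U}_{\mathrm{opt}}$-NE, then (a) $\mathbb{U}_{\mathrm{opt}}((R)^{-1})=(\mathbb{U}_{\mathrm{opt}}(R))^{-1}$ up to renaming of U symbols (namely $U^\rho_i=U^{(\rho)^{-1}}_{k-i+1}$ for $1\le i\le k$), (b) $R$ is $\mathbb{U}_{\mathrm{opt}}$-LL iff $(R)^{-1}$ is $\mathbb{U}_{\mathrm{opt}}$-RL, and (c) $R$ is $\mathbb{U}_{\mathrm{opt}}$-RL iff $(R)^{-1}$ is $\mathbb{U}_{\mathrm{opt}}$-LL; (3) $R$ is non-LV iff $(R)^{-1}$ is non-RV; (4) $R$ is non-RV iff $(R)^{-1}$ is non-LV.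
   Context: $\mathrm{Var}(\cdot)$ variables occurring; linear term: no variable twice. Extended conditional rule $\rho: l\to r\Leftarrow s_1\twoheadrightarrow t_1;\dots;s_k\twoheadrightarrow t_k$ ($k\ge0$, $l$ may be a variable); eCTRS = set of such rules; deterministic: $\mathrm{Var}(s_i)\subseteq\mathrm{Var}(l,t_1,\dots,t_{i-1})$ for all $i$; eDCTRS: all rules deterministic; Type 3: $\mathrm{Var}(r)\subseteq\mathrm{Var}(l,s_1,t_1,\dots,s_k,t_k)$; 3-eDCTRS: all rules deterministic and of Type 3. Rule properties: LL ($l$ linear), RL ($r$ linear), NE ($\mathrm{Var}(l)\subseteq\mathrm{Var}(r)$), non-LV ($l\notin\mathcal{V}$), non-RV ($r\notin\mathcal{V}$); a rule set has a property if all rules do. Inversion: $(l\to r\Leftarrow s_1\twoheadrightarrow t_1;\dots;s_k\twoheadrightarrow t_k)^{-1}=r\to l\Leftarrow t_k\twoheadrightarrow s_k;\dots;t_1\twoheadrightarrow s_1$, and $(R)^{-1}=\{(\rho)^{-1}\mid\rho\in R\}$ (for unconditional rules this just swaps sides). Optimized unraveling: for $k\ge1$, $X_i=\mathrm{Var}(l,t_1,\dots,t_{i-1})$, $Y_i=\mathrm{Var}(r,t_i,s_{i+1},t_{i+1},\dots,s_k,t_k)$, $Z_i=X_i\cap Y_i$, $\overrightarrow{X}$ a fixed listing of a finite set $X$, fresh symbols $U^\rho_1,\dots,U^\rho_k$; $\mathbb{U}_{\mathrm{opt}}(\rho)=\{l\to U^\rho_1(s_1,\overrightarrow{Z_1})\}\cup\{U^\rho_i(t_i,\overrightarrow{Z_i})\to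 U^\rho_{i+1}(s_{i+1},\overrightarrow{Z_{i+1}})\mid1\le i<k\}\cup\{U^\rho_k(t_k,\overrightarrow{Z_k})\to r\}$, unconditional rules kept, $\mathbb{U}_{\mathrm{opt}}(R)=\bigcup_\rho\mathbb{U}_{\mathrm{opt}}(\rho)$. $R$ is $\mathbb{U}_{\mathrm{opt}}$-P if all rules of $\mathbb{U}_{\mathrm{opt}}(R)$ have property P. *)

(* Defs.v *)
From HB Require Import structures.
From mathcomp Require Import all_boot finmap zify.
From mathcomp Require Import boolp classical_sets.

Set Implicit Arguments.
Unset Strict Implicit.
Unset Printing Implicit Defensive.

Local Open Scope fset_scope.
Local Open Scope classical_set_scope.
Local Open Scope nat_scope.

(** No arity discipline is imposed on [App]: every notion below is insensitive
    to arities, and terms over a fixed-arity signature are a special case. *)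
Inductive term (F V : Type) : Type :=
| Var of V
| App of F & seq (term F V).

Arguments Var {F V} _.
Arguments App {F V} _ _.

Fixpoint map_term (F G V : Type) (h : F -> G) (t : term F V) : term G V :=
  match t with
  | Var x => Var x
  | App f ts => App (h f) (map (map_term h) ts)
  end.

(** The variable occurrences of a term, from left to right. *)
Fixpoint occ (F V : Type) (t : term F V) : seq V :=
  match t with
  | Var x => [:: x]
  | App _ ts => flatten (map (@occ F V) ts)
  end.

Definition is_var (F V : Type) (t : term F V) : bool :=
  if t is Var _ then true else false.

Definition linear (F : Type) (V : eqType) (t : term F V) : bool := uniq (occ t).

(** [vars [:: t1; ...; tn]] is Var(t1, ..., tn). *)
Definition vars (F : Type) (V : choiceType) (ts : seq (term F V)) : {fset V} :=
  [fset x in flatten (map (@occ F V) ts)].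

(** [Rule l r [:: (s1, t1); ...; (sk, tk)]] is
    l -> r <= s1 ->> t1; ...; sk ->> tk. *)
Record rule (F V : Type) : Type := Rule {
  lhs : term F V;
  rhs : term F V;
  conds : seq (term F V * term F V)
}.

Definition map_rule (F G V : Type) (h : F -> G) (rho : rule F V) : rule G V :=
  Rule (map_term h (lhs rho)) (map_term h (rhs rho))
       [seq (map_term h c.1, map_term h c.2) | c <- conds rho].

Definition ncond (F V : Type) (rho : rule F V) : nat := size (conds rho).

(** [s_ rho i] and [t_ rho i] are the two sides of the [i]-th condition, counted
    from 1; they are meaningful only for [1 <= i <= ncond rho]. *)
Definition s_ (F V : Type) (rho : rule F V) (i : nat) : term F V :=
  nth (lhs rho) (unzip1 (conds rho)) i.-1.

Definition t_ (F V : Type) (rho : rule F V) (i : nat) : term F V :=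
  nth (lhs rho) (unzip2 (conds rho)) i.-1.

Section RuleProperties.
Variables (F : Type) (V : choiceType).
Implicit Type rho : rule F V.

(** Var(l, t_1, ..., t_{i-1}) *)
Definition X_ rho (i : nat) : {fset V} :=
  vars (lhs rho :: take i.-1 (unzip2 (conds rho))).

(** Var(r, t_i, s_{i+1}, t_{i+1}, ..., s_k, t_k) *)
Definition Y_ rho (i : nat) : {fset V} :=
  vars [:: rhs rho, t_ rho i & unzip1 (drop i (conds rho)) ++
                               unzip2 (drop i (conds rho))].

Definition Z_ rho (i : nat) : {fset V} := (X_ rho i `&` Y_ rho i)%fset.

Definition deterministic rho : Prop :=
  forall i, 1 <= i <= ncond rho -> (vars [:: s_ rho i] `<=` X_ rho i)%fset.

Definition type3 rho : Prop :=
  (vars [:: rhs rho] `<=`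
   vars (lhs rho :: unzip1 (conds rho) ++ unzip2 (conds rho)))%fset.

Definition LL rho : Prop := linear (lhs rho).
Definition RL rho : Prop := linear (rhs rho).
Definition NE rho : Prop := (vars [:: lhs rho] `<=` vars [:: rhs rho])%fset.
Definition nonLV rho : Prop := ~~ is_var (lhs rho).
Definition nonRV rho : Prop := ~~ is_var (rhs rho).

End RuleProperties.

(** An eCTRS is an arbitrary set of rules. *)
Notation eCTRS F V := (set (rule F V)).

Definition all_rules (F V : Type) (P : rule F V -> Prop) (R : eCTRS F V) : Prop :=
  forall rho, R rho -> P rho.

Definition eDCTRS (F : Type) (V : choiceType) (R : eCTRS F V) : Prop :=
  all_rules (@deterministic F V) R.

Definition eDCTRS3 (F : Type) (V : choiceType) (R : eCTRS F V) : Prop :=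
  all_rules (fun rho => deterministic rho /\ type3 rho) R.

Definition inv_rule (F V : Type) (rho : rule F V) : rule F V :=
  Rule (rhs rho) (lhs rho) (rev [seq (c.2, c.1) | c <- conds rho]).

Definition invR (F V : Type) (R : eCTRS F V) : eCTRS F V :=
  @inv_rule F V @` R.

(** [Usym rho i] is the symbol U^rho_i, used for [1 <= i <= ncond rho]. *)
Inductive usig (F V : Type) : Type :=
| Orig of F
| Usym of rule F V & nat.

Arguments Orig {F V} _.
Arguments Usym {F V} _ _.

Definition is_listing (V : choiceType) (ls : {fset V} -> seq V) : Prop :=
  forall X, uniq (ls X) /\ ls X =i X.

Section Unraveling.
Variables (F : Type) (V : choiceType) (ls : {fset V} -> seq V).
Implicit Types (rho : rule F V) (R : eCTRS F V).

Definition emb : term F V -> term (usig F V) V := map_term Orig.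

(** U^rho_i(t, Z_i) *)
Definition Uterm rho (i : nat) (t : term F V) : term (usig F V) V :=
  App (Usym rho i) (emb t :: map Var (ls (Z_ rho i))).

Definition Uopt_rule rho : eCTRS (usig F V) V :=
  let k := ncond rho in
  if k == 0 then [set map_rule Orig rho]
  else [set Rule (emb (lhs rho)) (Uterm rho 1 (s_ rho 1)) [::]] `|`
       [set Rule (Uterm rho i (t_ rho i)) (Uterm rho i.+1 (s_ rho i.+1)) [::]
         | i in [set i | 1 <= i < k]] `|`
       [set Rule (Uterm rho k (t_ rho k)) (emb (rhs rho)) [::]].

Definition Uopt R : eCTRS (usig F V) V := \bigcup_(rho in R) Uopt_rule rho.

Definition Uopt_has (P : rule (usig F V) V -> Prop) R : Prop :=
  all_rules P (Uopt R).

End Unraveling.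

(** The renaming U^rho_i |-> U^(rho^-1)_(k - i + 1), where k is the number of
    conditions of rho. Indices outside 1..k, which never occur in an unraveling,
    are kept, so that this is a permutation of the symbols. *)
Definition renU (F V : Type) (f : usig F V) : usig F V :=
  match f with
  | Orig g => Orig g
  | Usym rho i =>
      let k := ncond rho in
      Usym (inv_rule rho) (if 1 <= i <= k then k - i + 1 else i)
  end.

Lemma inv_ruleK (F V : Type) : involutive (@inv_rule F V).
Proof.
case=> l r cs; rewrite /inv_rule /= map_rev revK -map_comp.
by congr Rule; elim: cs => [|[s t] cs IH] //=; rewrite IH.
Qed.

Lemma renUK (F V : Type) : involutive (@renU F V).
Proof.
case=> [//|rho i]; rewrite /= inv_ruleK.
have -> : ncond (inv_rule rho) = ncond rho by rewrite /ncond size_rev size_map.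
congr Usym; case Hi: (1 <= i <= ncond rho); last by rewrite Hi.
by rewrite ifT; lia.
Qed.

(* Main.v *)
Require Import Defs.
From HB Require Import structures.
From mathcomp Require Import all_boot finmap zify.
From mathcomp Require Import boolp classical_sets.

Local Open Scope classical_set_scope.
Local Open Scope nat_scope.

(** Uniformly in the number k of conditions, U_opt(rho) consists of the rules
    [uL i -> uR i] for [0 <= i <= k], where
    [uL 0 = l], [uL i = U_i(t_i, Z_i)], [uR i = U_(i+1)(s_(i+1), Z_(i+1))] and
    [uR k = r]. Put W_i = Var(r, s_(i+1), ..., s_k), which is X_(k-i+1) of the
    inverse rule. If all these rules satisfy NE, then descending induction on i
    gives Var(uL i) <= Var(uR i) <= W_i: for i >= 1 this is determinism of the
    inverse rule, for i = 0 it gives Type 3. Conversely, these two properties of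
    the inverse give Var(uL i) <= W_i, and the part of Var(uL i) outside s_(i+1)
    is carried by Z_(i+1). Moreover, if rho and its inverse are
    both deterministic, then Y_i = W_i and Y_(k-i+1) of the inverse is X_i, so
    that the Z sets agree and inversion exchanges [uL i] and [uR (k - i)]. *)

Set Implicit Arguments.
Unset Strict Implicit.
Unset Printing Implicit Defensive.

Lemma occ_map_term (F G V : Type) (h : F -> G) (t : term F V) :
  occ (map_term h t) = occ t.
Proof.
(* The arguments sit in a list, so the recursion on terms is explicit and a list induction is nested
   in it. *)
move: t; fix IH 1 => -[x|f ts] //=; congr flatten; rewrite -map_comp.
by elim: ts => [//|t ts IHts] /=; rewrite IH IHts.
Qed.

Lemma map_term_comp (F G H V : Type) (g : G -> H) (h : F -> G) (t : term F V) :
  map_term g (map_term h t) = map_term (g \o h) t.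
Proof.
move: t; fix IH 1 => -[x|f ts] //=; congr App; rewrite -map_comp.
by elim: ts => [//|t ts IHts] /=; rewrite IH IHts.
Qed.

(** * Membership in the variable sets of a rule, by condition index *)

Section Variables_of_conditions.
Variables (F : Type) (V : choiceType).
Implicit Types (rho : rule F V) (t : term F V) (ts : seq (term F V)) (x : V).

Lemma in_vars ts x : (x \in vars ts) = has (fun t => x \in occ t) ts.
Proof. by rewrite in_fset /=; elim: ts => //= t ts IH; rewrite mem_cat IH. Qed.

Lemma in_X rho i x : i <= (ncond rho).+1 ->
  x \in X_ rho i <->
  x \in occ (lhs rho) \/ exists2 j, 1 <= j < i & x \in occ (t_ rho j).
Proof.
rewrite /X_ /ncond => le_ik; rewrite in_vars /=.
have sz : size (take i.-1 (unzip2 (conds rho))) = i.-1.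
  by rewrite size_takel // size_map; lia.
split=> [/orP[->|/(has_nthP (lhs rho))[j]]|[->//|[j ji xj]]]; first by left.
  rewrite sz => ji; rewrite nth_take // => xj; right.
  by exists j.+1 => //; lia.
apply/orP; right; apply/(has_nthP (lhs rho)); exists j.-1; rewrite ?sz; first lia.
by rewrite nth_take //; lia.
Qed.

Lemma in_Y rho i x :
  x \in Y_ rho i <->
  [\/ x \in occ (rhs rho), x \in occ (t_ rho i) |
      exists2 j, i < j <= ncond rho & x \in occ (s_ rho j) ++ occ (t_ rho j)].
Proof.
rewrite /Y_ /ncond in_vars /= has_cat /unzip1 /unzip2 !map_drop.
have drop_nth u : size u = size (conds rho) ->
    has (fun t => x \in occ t) (drop i u) <->
    exists2 j, i < j <= size (conds rho) & x \in occ (nth (lhs rho) u j.-1).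
  move=> szu; split=> [/(has_nthP (lhs rho))[j]|[j ji xj]].
    (* Position [j] of [drop i u], counted from 0, belongs to condition [i + j + 1]. *)
    by rewrite size_drop szu nth_drop => ji xj; exists (i + j).+1 => //; lia.
  apply/(has_nthP (lhs rho)); exists (j.-1 - i); first by rewrite size_drop; lia.
  by rewrite nth_drop subnKC //; lia.
have h1 := drop_nth (unzip1 (conds rho)) (size_map _ _).
have h2 := drop_nth (unzip2 (conds rho)) (size_map _ _).
split=> [/or4P[|||]|[->//|->|[j ji]]]; rewrite ?orbT //.
- by constructor 1.
- by constructor 2.
- by move/h1 => [j ji xj]; constructor 3; exists j; rewrite // mem_cat /s_ xj.
- move/h2 => [j ji xj]; constructor 3; exists j => //.
  by rewrite mem_cat /t_ xj orbT.
rewrite mem_cat => /orP[xj|xj]; apply/or4P.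
- by constructor 3; apply/h1; exists j.
- by constructor 4; apply/h2; exists j.
Qed.

Lemma deterministicP rho :
  deterministic rho <->
  forall i x, 1 <= i <= ncond rho -> x \in occ (s_ rho i) -> x \in X_ rho i.
Proof.
split=> [det i x ik xs|det i ik].
  by apply: (fsubsetP (det i ik)); rewrite in_vars /= xs.
by apply/fsubsetP => x; rewrite in_vars /= orbF; apply: det.
Qed.

Lemma type3P rho :
  type3 rho <->
  forall x, x \in occ (rhs rho) ->
  x \in occ (lhs rho) \/
  exists2 j, 1 <= j <= ncond rho & x \in occ (s_ rho j) ++ occ (t_ rho j).
Proof.
have hasE x u : size u = ncond rho -> has (fun t => x \in occ t) u <->
    exists2 j, 1 <= j <= ncond rho & x \in occ (nth (lhs rho) u j.-1).
  move=> szu; split=> [/(has_nthP (lhs rho))[j]|[j jk xj]].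
    by rewrite szu => jk xj; exists j.+1.
  by apply/(has_nthP (lhs rho)); exists j.-1 => //; lia.
split=> [t3 x xr|t3].
  have: x \in vars [:: rhs rho] by rewrite in_vars /= xr.
  move/(fsubsetP t3); rewrite in_vars /= has_cat => /or3P[->||]; first by left.
    move/(hasE x _ (size_map _ _)) => [j jk xj]; right; exists j => //.
    by rewrite mem_cat /s_ xj.
  move/(hasE x _ (size_map _ _)) => [j jk xj]; right; exists j => //.
  by rewrite mem_cat /t_ xj orbT.
apply/fsubsetP => x; rewrite !in_vars /= has_cat orbF => /t3[->//|[j jk]].
rewrite mem_cat => /orP[xj|xj]; apply/or3P.
  by constructor 2; apply/(hasE x _ (size_map _ _)); exists j.
by constructor 3; apply/(hasE x _ (size_map _ _)); exists j.
Qed.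

(** * Conditions and variable sets of the inverse rule *)

Lemma ncond_inv rho : ncond (inv_rule rho) = ncond rho.
Proof. by rewrite /ncond size_rev size_map. Qed.

Lemma s_inv rho i : 1 <= i <= ncond rho ->
  s_ (inv_rule rho) i = t_ rho (ncond rho - i + 1).
Proof.
rewrite /ncond /s_ /t_ /= /unzip1 /unzip2 map_rev -map_comp => ik.
rewrite nth_rev size_map; last lia.
(* The default of [s_] for the inverse is its own left side [rhs rho]; the index is in range, so the
   default may be exchanged. *)
rewrite (set_nth_default (lhs rho)) ?size_map; last lia.
by congr nth; lia.
Qed.

Lemma t_inv rho i : 1 <= i <= ncond rho ->
  t_ (inv_rule rho) i = s_ rho (ncond rho - i + 1).
Proof.
move=> ik; rewrite -{2}(inv_ruleK rho) s_inv ncond_inv; last lia.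
by congr t_; lia.
Qed.

(** The first k - i conditions of the inverse have the right sides s_k, ..., s_(i+1), so this set is
    W_i. *)
Lemma in_X_inv rho i x : i <= ncond rho ->
  x \in X_ (inv_rule rho) (ncond rho - i + 1) <->
  x \in occ (rhs rho) \/ exists2 j, i < j <= ncond rho & x \in occ (s_ rho j).
Proof.
move=> ik; rewrite in_X; last by rewrite ncond_inv; lia.
split=> -[|[j ji xj]]; [by left|right|by left|right].
  (* The reversal of indices, j to k - j + 1, is an involution and so gives the witness in both
     directions. *)
  exists (ncond rho - j + 1); first lia.
  by rewrite -t_inv //; lia.
exists (ncond rho - j + 1); first lia.
by rewrite t_inv; [rewrite (_ : _ - _ + _ = j) //; lia|lia].
Qed.

Lemma in_Y_inv rho i x : 1 <= i <= ncond rho ->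
  x \in Y_ (inv_rule rho) (ncond rho - i + 1) <->
  [\/ x \in occ (lhs rho), x \in occ (s_ rho i) |
      exists2 j, 1 <= j < i & x \in occ (s_ rho j) ++ occ (t_ rho j)].
Proof.
move=> ik; rewrite in_Y ncond_inv t_inv; last lia.
rewrite (_ : ncond rho - (ncond rho - i + 1) + 1 = i); last lia.
split=> -[||[j ji xj]]; try by [constructor 1|constructor 2].
  constructor 3; exists (ncond rho - j + 1); first lia.
  by rewrite -t_inv -?s_inv; [move: xj; rewrite !mem_cat orbC|lia|lia].
constructor 3; exists (ncond rho - j + 1); first lia.
rewrite t_inv ?s_inv; [|lia|lia].
by rewrite (_ : _ - _ + _ = j); [move: xj; rewrite !mem_cat orbC|lia].
Qed.

(** Besides the terms that make up X_i, the left-hand set collects only s_1, ..., s_i. Determinism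
    puts the variables of s_j into X_j, and X_j grows with j. *)
Lemma Y_inv_deterministic rho i :
  deterministic rho -> 1 <= i <= ncond rho ->
  Y_ (inv_rule rho) (ncond rho - i + 1) = X_ rho i.
Proof.
move=> /deterministicP det ik; apply/fsetP => x; apply/idP/idP; last first.
  rewrite in_X; last lia.
  rewrite in_Y_inv // => -[xl|[j ji xj]]; first by constructor 1.
  by constructor 3; exists j; rewrite // mem_cat xj orbT.
have X_mono j : 1 <= j <= i -> x \in X_ rho j -> x \in X_ rho i.
  move=> ji; rewrite !in_X; [|lia|lia].
  by case=> [xl|[m mj xm]]; [left|right; exists m => //; lia].
rewrite in_Y_inv // => -[xl|xs|[j ji]].
- by rewrite in_X; [left|lia].
- exact: det.
rewrite mem_cat => /orP[xj|xj].
  by apply: (X_mono j); [lia|apply: det => //; lia].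
by rewrite in_X; [right; exists j|lia].
Qed.

(** [Y_inv_deterministic], applied to the rule and to its inverse, shows that inversion exchanges
    the X and Y sets, and their intersection is symmetric. *)
Lemma Z_inv rho i :
  deterministic rho -> deterministic (inv_rule rho) -> 1 <= i <= ncond rho ->
  Z_ (inv_rule rho) i = Z_ rho (ncond rho - i + 1).
Proof.
move=> det deti ik.
have Yi := @Y_inv_deterministic rho (ncond rho - i + 1) det ltac:(lia).
have := @Y_inv_deterministic _ i deti; rewrite ncond_inv inv_ruleK => /(_ ik) Y_X.
rewrite /Z_ -Y_X -Yi fsetIC.
by rewrite (_ : ncond rho - (ncond rho - i + 1) + 1 = i) //; lia.
Qed.

End Variables_of_conditions.

(** * The unraveled rules, indexed from 0 to k *)

Section Unraveled_rules.
Variables (F : Type) (V : choiceType) (ls : {fset V} -> seq V).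
Hypothesis hls : is_listing ls.
Implicit Types (rho : rule F V) (R : eCTRS F V).

Definition uL rho i : term (usig F V) V :=
  if i == 0 then emb (lhs rho) else Uterm ls rho i (t_ rho i).

Definition uR rho i : term (usig F V) V :=
  if i == ncond rho then emb (rhs rho) else Uterm ls rho i.+1 (s_ rho i.+1).

(** For k = 0 the indices 0 and k coincide and give the unconditional rule that is kept. For
    positive k, index 0 is the first rule, index k the last, and the indices between them are the
    middle rules. *)
Lemma Uopt_ruleE rho :
  Uopt_rule ls rho = [set Rule (uL rho i) (uR rho i) [::]
                     | i in [set i | i <= ncond rho]].
Proof.
rewrite /Uopt_rule /uL /uR; case: (posnP (ncond rho)) => [k0|k0].
  have cs0 : conds rho = [::] by apply: size0nil.
  rewrite /map_rule cs0 /=; apply/seteqP; split=> [_ ->|_ [i /= ik <-]].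
    by exists 0; rewrite // k0.
  by rewrite k0 leqn0 in ik *; rewrite (eqP ik).
apply/seteqP; split=> [_ [[->|[i /= ik <-]]|->]|_ [i /= ik <-]].
- by exists 0; rewrite //= ltn_eqF.
- by exists i; [rewrite /=; lia|rewrite gtn_eqF ?ltn_eqF //; lia].
- by exists (ncond rho); rewrite //= eqxx gtn_eqF.
have [->|i0] := eqVneq i 0; first by left; left; rewrite ltn_eqF.
have [->|ine] := eqVneq i (ncond rho); first by right.
by left; right; exists i => //=; lia.
Qed.

Lemma occ_Uterm rho i t : occ (Uterm ls rho i t) = occ t ++ ls (Z_ rho i).
Proof.
by rewrite /= /emb occ_map_term -map_comp; congr cat; elim: (ls _) => //= ? ? ->.
Qed.

Lemma in_uL rho i x :
  x \in occ (uL rho i) =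
  if i == 0 then x \in occ (lhs rho)
  else (x \in occ (t_ rho i)) || (x \in Z_ rho i).
Proof.
rewrite /uL; case: eqP => _; first by rewrite /emb occ_map_term.
by rewrite occ_Uterm mem_cat (hls _).2.
Qed.

Lemma in_uR rho i x :
  x \in occ (uR rho i) =
  if i == ncond rho then x \in occ (rhs rho)
  else (x \in occ (s_ rho i.+1)) || (x \in Z_ rho i.+1).
Proof.
rewrite /uR; case: eqP => _; first by rewrite /emb occ_map_term.
by rewrite occ_Uterm mem_cat (hls _).2.
Qed.

(** * NE of the unraveling against determinism and Type 3 of the inverse *)

Lemma Uopt_rule_NE rho :
  all_rules (@NE _ V) (Uopt_rule ls rho) <->
  forall i x, i <= ncond rho -> x \in occ (uL rho i) -> x \in occ (uR rho i).
Proof.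
rewrite Uopt_ruleE; split=> [ne i x ik xL|ne _ [i /= ik <-]].
  have /fsubsetP/(_ x) := ne _ (ex_intro2 _ _ i ik erefl).
  by rewrite !in_vars /= !orbF; apply.
by apply/fsubsetP => x; rewrite !in_vars /= !orbF; apply: ne.
Qed.

Lemma NE_inv_deterministic rho :
  all_rules (@NE _ V) (Uopt_rule ls rho) ->
  deterministic (inv_rule rho) /\ type3 (inv_rule rho).
Proof.
move=> /Uopt_rule_NE ne.
(* Descending induction on [i], run as induction on [m], the distance to k. *)
have uL_W m i x : ncond rho - i = m -> i <= ncond rho -> x \in occ (uL rho i) ->
    x \in X_ (inv_rule rho) (ncond rho - i + 1).
  elim: m i => [|m IH] i im ik /(ne _ _ ik); rewrite in_uR in_X_inv //.
    by have -> : i = ncond rho by [lia]; rewrite eqxx; left.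
  case: eqP => [ik'|_]; first lia.
  case/orP => [xs|xZ]; first by right; exists i.+1 => //; lia.
  (* The same Z_(i+1) is carried on the left of the next rule, so the variable passes on to it. *)
  have: x \in occ (uL rho i.+1) by rewrite in_uL /= xZ orbT.
  move/IH; rewrite in_X_inv; last lia.
  case; [lia|lia|by left|move=> [j ji xj]]; right; exists j => //; lia.
split.
  apply/deterministicP => i x; rewrite ncond_inv => ik; rewrite s_inv // => xt.
  have: x \in X_ (inv_rule rho) (ncond rho - (ncond rho - i + 1) + 1).
    apply: (uL_W _ _ _ erefl); first lia.
    by rewrite in_uL xt ifF //; lia.
  by rewrite (_ : _ - _ + _ = i) //; lia.
(* Type 3 is the case i = 0: X_(k+1) of the inverse consists of its left side and all right sides of
   its conditions. *)
apply/type3P => x xl.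
have: x \in X_ (inv_rule rho) (ncond rho - 0 + 1).
  by apply: (uL_W _ _ _ erefl); rewrite ?in_uL.
rewrite in_X; last by rewrite ncond_inv; lia.
case=> [|[j jk xj]]; [by left|right; exists j; first by rewrite ncond_inv; lia].
by rewrite mem_cat xj orbT.
Qed.

Lemma inv_deterministic_NE rho :
  deterministic (inv_rule rho) -> type3 (inv_rule rho) ->
  all_rules (@NE _ V) (Uopt_rule ls rho).
Proof.
move=> /deterministicP det /type3P t3; apply/Uopt_rule_NE => i x ik.
(* Determinism of the inverse at its condition k - j + 1, whose left side is t_j. *)
have t_W j : 1 <= j <= ncond rho -> x \in occ (t_ rho j) ->
    x \in occ (rhs rho) \/ exists2 m, j < m <= ncond rho & x \in occ (s_ rho m).
  move=> jk xj; rewrite -in_X_inv; last lia.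
  apply: det; first by rewrite ncond_inv; lia.
  by rewrite s_inv; [rewrite (_ : _ - _ + _ = j) //; lia|lia].
have Y_s j m : j < m <= ncond rho -> x \in occ (s_ rho m) -> x \in Y_ rho j.
  by move=> jm xm; rewrite in_Y; constructor 3; exists m; rewrite // mem_cat xm.
have Y_r j : x \in occ (rhs rho) -> x \in Y_ rho j.
  by move=> xr; rewrite in_Y; constructor 1.
(* For i < k, a variable of W_i either occurs in s_(i+1) or lies in Y_(i+1), through r or a later
   s_m. In the latter case membership in X_(i+1) puts it into Z_(i+1). *)
have W_step : x \in occ (rhs rho) \/
    (exists2 m, i < m <= ncond rho & x \in occ (s_ rho m)) ->
    (i < ncond rho -> x \in X_ rho i.+1) -> x \in occ (uR rho i).
  rewrite in_uR; case: eqP => [->|ne] xW xX.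
    by case: xW => [//|[m mk]]; lia.
  have ltik : i < ncond rho by lia.
  case: xW => [xr|[m mk xm]]; first by rewrite /Z_ in_fsetI xX // Y_r ?orbT.
  have [mi|mi] := eqVneq m i.+1; first by rewrite -mi xm.
  by rewrite /Z_ in_fsetI xX // (Y_s _ m) ?orbT //; lia.
rewrite in_uL; case: eqP => [i0|/eqP i0].
  move=> xl; apply: W_step; last by move=> ?; rewrite in_X; [left|lia].
  (* Type 3 of the inverse places a variable of l in r or in some condition; an occurrence in a t_j
     is pushed by [t_W] to r or a later s_m. *)
  have [|[j jk]] := t3 x xl; first by left.
  rewrite ncond_inv in jk; rewrite s_inv // t_inv // mem_cat => /orP[] xj.
    case: (t_W _ _ xj) => [|xr|[m mj xm]]; [lia|by left|].
    by right; exists m => //; lia.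
  by right; exists (ncond rho - j + 1) => //; lia.
have i_gt0 : 1 <= i <= ncond rho by lia.
case/orP => [xt|].
  apply: W_step; first exact: t_W.
  by move=> ?; rewrite in_X; [right; exists i => //; lia|lia].
(* Here Y_i lies in W_i, again by [t_W], and X_i lies in X_(i+1). *)
rewrite /Z_ in_fsetI => /andP[xX xY]; apply: W_step.
  move: xY; rewrite in_Y => -[xr|/t_W|[j ij]]; [by left|exact|].
  rewrite mem_cat => /orP[xj|xj]; first by right; exists j.
  case: (t_W _ _ xj) => [|xr|[m mj xm]]; [lia|by left|].
  by right; exists m => //; lia.
move=> ?; move: xX; rewrite !in_X; [|lia|lia].
by case=> [xl|[j ji xj]]; [left|right; exists j => //; lia].
Qed.

(** * Unraveling commutes with inversion up to renaming *)

Lemma map_renU_Uterm rho i t :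
  deterministic rho -> deterministic (inv_rule rho) -> 1 <= i <= ncond rho ->
  map_term (@renU F V) (Uterm ls (inv_rule rho) i t) =
  Uterm ls rho (ncond rho - i + 1) t.
Proof.
move=> det deti ik; rewrite /Uterm /= ncond_inv ik inv_ruleK.
(* As [ls] is a function of the set, equal Z sets give the same argument list, order included. *)
rewrite Z_inv // /emb map_term_comp; congr App; congr cons.
by rewrite -map_comp; apply: eq_map.
Qed.

Lemma map_renU_uL rho i :
  deterministic rho -> deterministic (inv_rule rho) -> i <= ncond rho ->
  map_term (@renU F V) (uL (inv_rule rho) i) = uR rho (ncond rho - i).
Proof.
move=> det deti ik; rewrite /uL /uR; case: eqP => [->|/eqP i0].
  by rewrite subn0 eqxx /emb map_term_comp.
rewrite ltn_eqF; last lia.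
rewrite map_renU_Uterm //; last lia.
by rewrite t_inv ?addn1 //; lia.
Qed.

Lemma map_renU_uR rho i :
  deterministic rho -> deterministic (inv_rule rho) -> i <= ncond rho ->
  map_term (@renU F V) (uR (inv_rule rho) i) = uL rho (ncond rho - i).
Proof.
move=> det deti ik; rewrite /uL /uR ncond_inv; case: eqP => [->|/eqP i0].
  by rewrite subnn /emb map_term_comp.
rewrite gtn_eqF; last lia.
rewrite map_renU_Uterm //; last lia.
rewrite s_inv; last lia.
by rewrite (_ : ncond rho - i.+1 + 1 = ncond rho - i) //; lia.
Qed.

(** After renaming, rule i of the unraveled inverse is the inverse of rule k - i. *)
Lemma Uopt_rule_inv rho :
  deterministic rho -> deterministic (inv_rule rho) ->
  map_rule (@renU F V) @` Uopt_rule ls (inv_rule rho) =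
  invR (Uopt_rule ls rho).
Proof.
move=> det deti; rewrite !Uopt_ruleE ncond_inv /invR.
apply/seteqP; split=> _ [_ [i /= ik <-] <-].
  exists (Rule (uL rho (ncond rho - i)) (uR rho (ncond rho - i)) [::]).
    by exists (ncond rho - i) => //=; lia.
  by rewrite /inv_rule /map_rule /= map_renU_uL ?map_renU_uR.
exists (Rule (uL (inv_rule rho) (ncond rho - i))
             (uR (inv_rule rho) (ncond rho - i)) [::]).
  by exists (ncond rho - i) => //=; lia.
by rewrite /inv_rule /map_rule /= map_renU_uL ?map_renU_uR ?subKn //; lia.
Qed.

Lemma Uopt_inv R :
  eDCTRS R -> eDCTRS (invR R) ->
  map_rule (@renU F V) @` Uopt ls (invR R) = invR (Uopt ls R).
Proof.
move=> det deti.
have rule_inv rho : R rho -> map_rule (@renU F V) @` Uopt_rule ls (inv_rule rho)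
    = invR (Uopt_rule ls rho).
  by move=> Rrho; apply: Uopt_rule_inv; [apply: det|apply: deti; exists rho].
apply/seteqP; split.
  move=> _ [sigma [_ [rho Rrho <-] hsigma] <-].
  have : (map_rule (@renU F V) @` Uopt_rule ls (inv_rule rho))
           (map_rule (@renU F V) sigma) by exists sigma.
  by rewrite rule_inv // => -[tau htau <-]; exists tau => //; exists rho.
move=> _ [sigma [rho Rrho hsigma] <-].
have : invR (Uopt_rule ls rho) (inv_rule sigma) by exists sigma.
rewrite -rule_inv // => -[tau htau <-]; exists tau => //.
by exists (inv_rule rho) => //; exists rho.
Qed.

End Unraveled_rules.

(** * Transfer of rule properties along inversion and renaming, and the final assembly *)

Lemma all_rules_inv (F V : Type) (P Q : rule F V -> Prop) (R : eCTRS F V) :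
  (forall rho, Q (inv_rule rho) <-> P rho) ->
  all_rules P R <-> all_rules Q (invR R).
Proof.
move=> PQ; split=> [h _ [rho Rrho <-]|h rho Rrho]; first exact/PQ/h.
by apply/PQ/h; exists rho.
Qed.

Lemma all_rules_map (F G V : Type) (h : F -> G) (P : rule F V -> Prop)
    (Q : rule G V -> Prop) (R : eCTRS F V) :
  (forall rho, Q (map_rule h rho) <-> P rho) ->
  all_rules Q (map_rule h @` R) <-> all_rules P R.
Proof.
move=> PQ; split=> [H rho Rrho|H _ [rho Rrho <-]]; last exact/PQ/H.
by apply/PQ/H; exists rho.
Qed.

Theorem theorem4p7 (F : Type) (V : choiceType) (ls : {fset V} -> seq V)
    (hls : is_listing ls) (R : eCTRS F V) (hR : eDCTRS R) :
  [/\ Uopt_has ls (@NE _ V) R <-> eDCTRS3 (invR R),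
      Uopt_has ls (@NE _ V) R ->
        [/\ map_rule (@renU F V) @` Uopt ls (invR R) = invR (Uopt ls R),
            Uopt_has ls (@LL _ V) R <-> Uopt_has ls (@RL _ V) (invR R)
          & Uopt_has ls (@RL _ V) R <-> Uopt_has ls (@LL _ V) (invR R)],
      all_rules (@nonLV F V) R <-> all_rules (@nonRV F V) (invR R)
    & all_rules (@nonRV F V) R <-> all_rules (@nonLV F V) (invR R)].
Proof.
have NE_iff : Uopt_has ls (@NE _ V) R <-> eDCTRS3 (invR R).
  split=> [ne _ [rho Rrho <-]|inv3 sigma [rho Rrho hsigma]].
    apply: (NE_inv_deterministic hls) => sigma hsigma.
    by apply: ne; exists rho.
  have [|det t3] := inv3 (inv_rule rho); first by exists rho.
  exact: (inv_deterministic_NE hls det t3 hsigma).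
(* Inversion swaps the two sides, which settles the claims on variable sides. *)
split=> //; [|exact: all_rules_inv..].
move=> /NE_iff inv3.
have inv_eq : map_rule (@renU F V) @` Uopt ls (invR R) = invR (Uopt ls R).
  (* NE enters through the determinism of the inverse system. *)
  by apply: Uopt_inv => // rho /inv3[].
split=> //; rewrite /Uopt_has.
  (* LL becomes RL on the inverted unraveling, which is a renaming of the unraveling of the inverse;
     linearity depends only on variable occurrences, and renaming preserves them. *)
  rewrite (@all_rules_inv _ _ _ (@RL _ V)) // -inv_eq; apply: all_rules_map.
  by move=> rho; rewrite /RL /linear occ_map_term.
rewrite (@all_rules_inv _ _ _ (@LL _ V)) // -inv_eq; apply: all_rules_map.
by move=> rho; rewrite /LL /linear occ_map_term.
Qed.
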